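(* Let $\mathcal{I}$ be a countably infinite set equipped with a Borcherds-Cartan form $(-,-)$, and let $\mathbf{B}$ be the associated $q$-boson (Kashiwara algebra). Then there exists an object of the category $\mathcal{O}(\mathbf{B})$ which is not semisimple, i.e. which is not a sum of simple objects of $\mathcal{O}(\mathbf{B})$.
   Context: Borcherds-Cartan form: for a countable set $\mathcal{I}$, a Borcherds-Cartan form on $\mathcal{I}$ is a non-degenerate $\mathbf{Q}$-valued bilinear form $(-,-)$ (i.e. a non-degenerate bilinear form on the $\mathbf{Q}$-vector space with basis $\mathcal{I}$) such that: (a) it is symmetric; (b) $(i,j)\le 0$ for all $i\neq j$ in $\mathcal{I}$; (c) for $i,j\in\mathcal{I}$, $\frac{2(i,j)}{(i,i)}$ is an integer whenever $(i,i)>0$. An element $i\in\mathcal{I}$ is called real if $(i,i)>0$ and imaginary if $(i,i)\le 0$. For $i$ real put $a_{ij}=-\frac{2(i,j)}{(i,i)}$, $d_i=\frac{(i,i)}{2}$ and $q_i=q^{d_i}$. Ground field: $q$ is an indeterminate and the ground field is $\mathbf{Q}(q)$; if the form takes non-integer rational values, the ground field is understood to be enlarged so as to contain the rational powers of $q$ that occur (for instance the field $\bigcup_{n\ge 1}\mathbf{Q}(q^{1/n})$, with compatible roots $q^{1/n}$). The $q$-boson $\mathbf{B}$: the associative unital algebra over the ground field generated by symbols $E_i, F_i$ ($i\in\mathcal{I}$) subject to the relations $$F_iE_j=q^{(i,j)}E_jF_i+\delta_{ij}\qquad (i,j\in\mathcal{I}),$$ $$\sum_{t=0}^{a_{ij}+1}(-1)^t\left[\begin{array}{c}a_{ij}+1\\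 t\end{array}\right]_{d_i}E_i^{t}E_jE_i^{a_{ij}+1-t}=0\qquad (i \text{ real},\ j\neq i),$$ $$\sum_{t=0}^{a_{ij}+1}(-1)^t\left[\begin{array}{c}a_{ij}+1\\ t\end{array}\right]_{d_i}F_i^{t}F_jF_i^{a_{ij}+1-t}=0\qquad (i \text{ real},\ j\neq i),$$ $$E_iE_j-E_jE_i=0,\qquad F_iF_j-F_jF_i=0\qquad \text{whenever } (i,j)=0.$$ Here $\left[\begin{array}{c}n\\ t\end{array}\right]_{d_i}$ is the standard (symmetric) quantum binomial coefficient in the variable $q_i$, i.e. $\frac{[n]!}{[t]!\,[n-t]!}$ with $[m]=\frac{q_i^{m}-q_i^{-m}}{q_i-q_i^{-1}}$ and $[m]!=[1][2]\cdots[m]$. The category $\mathcal{O}(\mathbf{B})$: the full subcategory of left $\mathbf{B}$-modules $M$ such that for every $u\in M$ there exists an integer $l$ with $F_{i_1}F_{i_2}\cdots F_{i_l}u=0$ for all $i_1,\dots,i_l\in\mathcal{I}$. It is closed under submodules, quotients and extensions, so its simple objects are exactly the simple $\mathbf{B}$-modules lying in it. *)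

(* Defs.v *)
From HB Require Import structures.
From mathcomp Require Import all_boot all_order all_algebra.
From mathcomp Require Export finmap.
From mathcomp Require Export boolp classical_sets functions cardinality.

Set Implicit Arguments.
Unset Strict Implicit.
Unset Printing Implicit Defensive.

Import Order.TTheory GRing.Theory Num.Theory.

Local Open Scope ring_scope.

(* A bilinear form on the Q-vector space with basis I is given by its values  *)
(* b i j on the basis; the vectors are the finitely supported functions.      *)

Definition bilinear_ext (I : choiceType) (b : I -> I -> rat)
    (x y : {fsfun I -> rat with 0}) : rat :=
  \sum_(i <- finsupp x) \sum_(j <- finsupp y) x i * y j * b i j.

Record Borcherds_Cartan (I : choiceType) (b : I -> I -> rat) : Prop := {
  BC_nondegl : forall x : {fsfun I -> rat with 0},
    (forall y, bilinear_ext b x y = 0) -> x = [fsfun];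
  BC_nondegr : forall y : {fsfun I -> rat with 0},
    (forall x, bilinear_ext b x y = 0) -> y = [fsfun];
  BC_sym : forall i j, b i j = b j i;
  BC_le0 : forall i j, i != j -> b i j <= 0;
  BC_int : forall i j, 0 < b i i -> 2 * b i j / b i i \is a Num.int
}.

(* For a Borcherds-Cartan form, i real and j != i, the rational number        *)
(* - 2 (i, j) / (i, i) is a natural number, so Num.truncn loses nothing.      *)
Definition cartan_a (I : choiceType) (b : I -> I -> rat) (i j : I) : nat :=
  Num.truncn (- (2 * b i j / b i i)).

(* The field Q(q^r : r in L), for a subgroup L of (Q, +) containing 1, with   *)
(* its system of compatible powers q^r. It is characterized up to isomorphism *)
(* as the field generated by a family q^r (r in L) of multiplicative powers   *)
(* of a q that is transcendental over Q (which forces characteristic 0):      *)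
(* L = Z gives Q(q), and L = Q gives the union of all the Q(q^(1/n)).         *)
(* The values of qpow outside of L are irrelevant.                            *)
Record is_Qq (L : zmodClosed rat) (K : fieldType) (qpow : rat -> K) : Prop := {
  Qq_1 : 1 \in L;
  Qq_pow0 : qpow 0 = 1;
  Qq_powD : forall r s, r \in L -> s \in L -> qpow (r + s) = qpow r * qpow s;
  Qq_transcendental : forall p : {poly rat},
    p != 0 -> (map_poly ratr p).[qpow 1] != 0;
  Qq_generated : forall S : {pred K}, GRing.divring_closed S ->
    (forall r, r \in L -> qpow r \in S) -> forall x, x \in S
}.

(* All the exponents of q occurring in the relations of B are combinations of *)
(* the (i, j) and, for i real, of d_i = (i, i) / 2.                           *)
Definition exponents_in (I : choiceType) (b : I -> I -> rat)
    (L : zmodClosed rat) : Prop :=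
  (forall i j, b i j \in L) /\ (forall i, 0 < b i i -> b i i / 2 \in L).

Definition qint (K : fieldType) (v : K) (m : nat) : K :=
  (v ^+ m - v ^- m) / (v - v^-1).

Definition qfact (K : fieldType) (v : K) (m : nat) : K :=
  \prod_(1 <= k < m.+1) qint v k.

Definition qbinom (K : fieldType) (v : K) (n t : nat) : K :=
  qfact v n / (qfact v t * qfact v (n - t)).

Definition q_serre (K : fieldType) (A : algType K) (v : K) (a : nat)
    (x y : A) : A :=
  \sum_(0 <= t < a.+2)
    ((-1) ^+ t * qbinom v a.+1 t) *: (x ^+ t * y * x ^+ (a.+1 - t)).

Record qboson_relations (I : choiceType) (b : I -> I -> rat) (K : fieldType)
    (qpow : rat -> K) (A : algType K) (E F : I -> A) : Prop := {
  qboson_FE : forall i j,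
    F i * E j = qpow (b i j) *: (E j * F i) + (i == j)%:R;
  qboson_serreE : forall i j, 0 < b i i -> j != i ->
    q_serre (qpow (b i i / 2)) (cartan_a b i j) (E i) (E j) = 0;
  qboson_serreF : forall i j, 0 < b i i -> j != i ->
    q_serre (qpow (b i i / 2)) (cartan_a b i j) (F i) (F j) = 0;
  qboson_commE : forall i j, b i j = 0 -> E i * E j - E j * E i = 0;
  qboson_commF : forall i j, b i j = 0 -> F i * F j - F j * F i = 0
}.

(* The K-algebra presented by generators E_i, F_i and the relations above,    *)
(* specified by its universal property.                                       *)
Record is_qboson (I : choiceType) (b : I -> I -> rat) (K : fieldType)
    (qpow : rat -> K) (B : algType K) (E F : I -> B) : Prop := {
  qboson_rel : qboson_relations b qpow E F;
  qboson_ex : forall (A : algType K) (e f : I -> A),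
    qboson_relations b qpow e f ->
    exists phi : {lrmorphism B -> A},
      (forall i, phi (E i) = e i) /\ (forall i, phi (F i) = f i);
  qboson_uniq : forall (A : algType K) (phi psi : {lrmorphism B -> A}),
    (forall i, phi (E i) = psi (E i)) -> (forall i, phi (F i) = psi (F i)) ->
    phi =1 psi
}.

(* [:: i_1; ...; i_l] and u are sent to F_(i_1) ( ... (F_(i_l) u)).           *)
Definition F_word (I : Type) (R : nzRingType) (F : I -> R) (M : lmodType R)
    (s : seq I) (u : M) : M :=
  foldr (fun i v => F i *: v) u s.

Definition F_nilpotent (I : Type) (R : nzRingType) (F : I -> R)
    (M : lmodType R) (u : M) : Prop :=
  exists l : nat, forall s : l.-tuple I, F_word F s u = 0.

Definition in_O (I : Type) (R : nzRingType) (F : I -> R) (M : lmodType R) :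
    Prop :=
  forall u : M, F_nilpotent F u.

(* N is a submodule of M that is a simple object of the category O.           *)
Record simple_O_sub (I : Type) (R : nzRingType) (F : I -> R) (M : lmodType R)
    (N : {pred M}) : Prop := {
  simple_submod : GRing.submod_closed N;
  simple_in_O : forall u, u \in N -> F_nilpotent F u;
  simple_neq0 : exists2 u, u \in N & u != 0;
  simple_min : forall N' : {pred M}, GRing.submod_closed N' ->
    {subset N' <= N} -> N' =i pred1 0 \/ N' =i N
}.

(* M is the (not necessarily finite) sum of its simple subobjects: every      *)
(* element is a finite sum of elements of simple subobjects.                  *)
Definition semisimple_O (I : Type) (R : nzRingType) (F : I -> R)
    (M : lmodType R) : Prop :=
  forall u : M, exists2 s : seq M, u = \sum_(v <- s) v &
    forall v, v \in s -> exists2 N : {pred M}, simple_O_sub F N & v \in N.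

(* Main.v *)
Require Import Defs.
From HB Require Import structures.
From mathcomp Require Import all_boot all_order all_algebra.
From mathcomp Require Import ring.
Import Order.TTheory GRing.Theory Num.Theory.
Local Open Scope classical_set_scope.
Local Open Scope ring_scope.

Set Implicit Arguments.
Unset Strict Implicit.
Unset Printing Implicit Defensive.

(** Over infinitely many letters, the function that is 1 on every word of length
one is an infinite sum of vectors E_i vac, so it lies outside the submodule
generated by the vacuum vac, although that submodule meets every nonzero
submodule. A module with such a vector is not a sum of simple submodules.

The module is a part of the space of all functions on words in I. On this space
F_i acts by prepending the letter i to the argument, and the relation between F
and E then dictates E_k by recursion on the word ([q_insert]): E_k inserts the
letter k at every place, with powers of q as weights. Infinite sums cause no
trouble because each value is a finite sum.

The Serre elements and the commutators, called relators here, q-commute: F_k R =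
z R F_k for a relator R in the E's, and R E_k = z E_k R for a relator R in the
F's ([relatorE_skew_comm], [relatorF_skew_comm]). This rests on the identities
binom(a+1, t+1) [t+1] = binom(a+1, t) [a+1-t] and sum_t (-1)^t binom(a+1, t)
v^(-at) = 0 for quantum binomials; q is not a root of unity, so that these
binomials are genuine quotients. Consequently the relators in the E's vanish on
all functions on words, by induction on the word, since their values at the
empty word are zero. The relators in the F's need not vanish there, but the
functions all of whose F-derivatives they kill form a space stable under all the
E's and F's. Its elements that vanish on all long words make up the module
[Fock], which lies in the category O for degree reasons, and which contains
every function supported on words of length at most one.

A nonzero vector of [Fock] is turned by suitable F's into a nonzero multiple of
the vacuum, the indicator of the empty word ([submod_vac]). The functions whose
support involves only finitely many letters form a submodule containing the
vacuum, hence containing every simple submodule. The function equal to 1 on all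
words of length one is not among them, so it is not a sum of elements of simple
submodules. *)

(** * The algebra of linear endomorphisms *)

Section LinearEndomorphisms.
Variables (K : fieldType) (V : lmodType K).

Definition linear_pred : {pred (V -> V)} := [pred f : V -> V | `[< linear f >]].

Lemma linear_predP (f : V -> V) : reflect (linear f) (f \in linear_pred).
Proof. exact: asboolP. Qed.

Lemma linear_pred_submod : GRing.submod_closed linear_pred.
Proof.
split=> [|a f g /linear_predP f_lin /linear_predP g_lin];
  apply/linear_predP=> c x y.
  by rewrite [LHS]/(0 : V) [X in _ = c *: X + _]/(0 : V) scaler0 add0r.
rewrite [LHS]/(a *: f (c *: x + y) + g (c *: x + y)) f_lin g_lin.
rewrite [X in _ = c *: X + _]/(a *: f x + g x).
rewrite [X in _ = _ + X]/(a *: f y + g y).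
by rewrite !scalerDr !scalerA [a * c]mulrC addrACA.
Qed.
HB.instance Definition _ :=
  GRing.isSubmodClosed.Build K (V -> V) linear_pred linear_pred_submod.

(** Algebras are nontrivial by definition, so the type of endomorphisms carries a
witness that the space is nonzero. *)
Record lend (v : V) (vN0 : v != 0) :=
  Lend {lend_fun : V -> V; _ : lend_fun \in linear_pred}.

Variables (v : V) (vN0 : v != 0).
Notation lendV := (lend vN0).
HB.instance Definition _ := [isSub for @lend_fun v vN0].
HB.instance Definition _ := [Choice of lendV by <:].
HB.instance Definition _ := [SubChoice_isSubLmodule of lendV by <:].

Lemma lend_linear (f : lendV) : linear (lend_fun f).
Proof. by apply/linear_predP; case: f. Qed.
HB.instance Definition _ (f : lendV) :=
  GRing.isLinear.Build K V V *:%R (lend_fun f) (lend_linear f).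

Lemma lend_inj (f g : lendV) : lend_fun f =1 lend_fun g -> f = g.
Proof. by move=> fg; apply/val_inj/funext. Qed.

Lemma id_linear_pred : id \in linear_pred.
Proof. by apply/linear_predP. Qed.

Lemma comp_linear_pred (f g : lendV) : lend_fun f \o lend_fun g \in linear_pred.
Proof. by apply/linear_predP=> c x y /=; rewrite !lend_linear. Qed.

Definition lend1 : lendV := Lend vN0 id_linear_pred.
Definition lend_mul (f g : lendV) : lendV := Lend vN0 (comp_linear_pred f g).

Lemma lend_mulA : associative lend_mul.
Proof. by move=> f g h; exact: lend_inj. Qed.
Lemma lend_mul1l : left_id lend1 lend_mul.
Proof. by move=> f; exact: lend_inj. Qed.
Lemma lend_mul1r : right_id lend1 lend_mul.
Proof. by move=> f; exact: lend_inj. Qed.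
Lemma lend_mulDl : left_distributive lend_mul +%R.
Proof. by move=> f g h; exact: lend_inj. Qed.
Lemma lend_mulDr : right_distributive lend_mul +%R.
Proof.
by move=> f g h; apply: lend_inj => x; exact: linearD.
Qed.
Lemma lend1_neq0 : lend1 != 0.
Proof.
by apply: contra_neq vN0 => e; rewrite -[LHS]/(lend_fun lend1 v) e.
Qed.
HB.instance Definition _ := GRing.Zmodule_isNzRing.Build lendV
  lend_mulA lend_mul1l lend_mul1r lend_mulDl lend_mulDr lend1_neq0.

Lemma lend_scaleAl (a : K) (f g : lendV) : a *: (f * g) = (a *: f) * g.
Proof. exact: lend_inj. Qed.
HB.instance Definition _ := GRing.Lmodule_isLalgebra.Build K lendV lend_scaleAl.
Lemma lend_scaleAr (a : K) (f g : lendV) : a *: (f * g) = f * (a *: g).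
Proof.
by apply: lend_inj => x; apply/esym; exact: linearZZ.
Qed.
HB.instance Definition _ := GRing.Lalgebra_isAlgebra.Build K lendV lend_scaleAr.

End LinearEndomorphisms.

(** * Quantum binomials *)

Section QuantumBinomials.
Variables (K : fieldType) (v : K).
Hypothesis v_neq0 : v != 0.
Hypothesis v_nroot : forall m, (0 < m)%N -> v ^+ m != v ^- m.

Lemma v_subV_neq0 : v - v^-1 != 0.
Proof. by rewrite subr_eq0; have := v_nroot (ltn0Sn 0); rewrite !expr1. Qed.

Lemma qint_neq0 m : (0 < m)%N -> qint v m != 0.
Proof.
move=> m_gt0; rewrite mulf_neq0 ?subr_eq0 ?v_nroot // invr_neq0 //.
exact: v_subV_neq0.
Qed.

Lemma qfactS m : qfact v m.+1 = qfact v m * qint v m.+1.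
Proof. by rewrite /qfact big_nat_recr. Qed.

Lemma qfact_neq0 m : qfact v m != 0.
Proof.
elim: m => [|m IHm]; first by rewrite /qfact big_geq ?oner_neq0.
by rewrite qfactS mulf_neq0 ?qint_neq0.
Qed.

Lemma qfact0 : qfact v 0 = 1.
Proof. by rewrite /qfact big_geq. Qed.

Lemma qbinom0 n : qbinom v n 0 = 1.
Proof. by rewrite /qbinom subn0 qfact0 mul1r divff ?qfact_neq0. Qed.

Lemma qbinomn n : qbinom v n n = 1.
Proof. by rewrite /qbinom subnn qfact0 mulr1 divff ?qfact_neq0. Qed.

Lemma qbinom_sub n t : (t <= n)%N -> qbinom v n (n - t) = qbinom v n t.
Proof. by move=> le_tn; rewrite /qbinom subKn // [X in _ / X]mulrC. Qed.

Lemma qbinomSr n t : (t < n)%N ->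
  qbinom v n t.+1 * qint v t.+1 = qbinom v n t * qint v (n - t).
Proof.
move=> lt_tn; rewrite /qbinom qfactS -[in qfact v (n - t)](subnSK lt_tn) qfactS.
rewrite (subnSK lt_tn).
have := qfact_neq0 t; have := qfact_neq0 (n - t.+1).
have := @qint_neq0 t.+1 isT; have : qint v (n - t) != 0.
  by rewrite qint_neq0 ?subn_gt0.
by move=> *; field; do ![apply/andP; split=> //].
Qed.

Lemma qbinomSS n t : (t <= n)%N ->
  qbinom v n.+1 t.+1 * qint v t.+1 = qbinom v n t * qint v n.+1.
Proof.
move=> le_tn; rewrite /qbinom subSS !qfactS.
have := qfact_neq0 t; have := qfact_neq0 (n - t).
have := @qint_neq0 t.+1 isT.
by move=> *; field; do ![apply/andP; split=> //].
Qed.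

Lemma sqr_sub1_neq0 : v * v - 1 != 0.
Proof.
rewrite -[X in _ - X](mulfV v_neq0) -mulrBr mulf_neq0 //.
exact: v_subV_neq0.
Qed.

(** The unbalanced quantum integer in v^2 that comes from moving an F past a power
of an E. *)
Lemma sum_sqr_qint n : \sum_(k < n.+1) (v ^+ 2) ^+ k = v ^+ n * qint v n.+1.
Proof.
apply: (mulfI sqr_sub1_neq0); rewrite -expr2 -subrX1 /qint -exprM mulnC exprM.
rewrite !exprS expr0 mulr1; have := sqr_sub1_neq0; have := expf_neq0 n v_neq0.
by move: (v ^+ n) => X X0 vv; field; apply/and3P.
Qed.

(** The q-Pascal rule binom(a+1, t) = v^(-t) binom(a, t) + v^(a+1-t) binom(a, t-1)
makes the terms telescope; this is the resulting closed form. It stops at s = a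
because [qbinom v a t] is not zero for t > a. *)
Lemma alternating_qbinom_partial a s : (s <= a)%N ->
  \sum_(0 <= t < s.+1) (-1) ^+ t * qbinom v a.+1 t * (v ^- a) ^+ t =
  (-1) ^+ s * qbinom v a s * (v ^- a.+1) ^+ s.
Proof.
elim: s => [|s IHs] le_sa.
  by rewrite big_nat1 !expr0 !qbinom0.
rewrite big_nat_recr //= IHs ?(ltnW le_sa) //.
have q_neq0 := @qint_neq0 s.+1 isT.
have := qbinomSS (ltnW le_sa) => /(canRL (mulfK q_neq0)) ->.
have := qbinomSr le_sa => /(canRL (mulfK q_neq0)) ->.
have -> : v ^- a.+1 = v ^- a * v^-1 by rewrite exprSr invfM mulrC.
rewrite !exprMn !exprVn ![_ ^+ s.+1]exprS.
(* From here on it is an identity between rational functions of v, v^s and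
   v^(a-s). *)
have -> : (a = (a - s) + s)%N by rewrite subnK // ltnW.
rewrite addnK; move: (a - s)%N => d.
have := expf_neq0 s (expf_neq0 (d + s) v_neq0).
move: ((v ^+ (d + s)) ^+ s) (qbinom v _ s) => Y B Y_neq0.
move: (expf_neq0 s v_neq0) (expf_neq0 d v_neq0) v_subV_neq0
  q_neq0 sqr_sub1_neq0.
rewrite /qint -addSn !exprD !exprS.
move: (v ^+ s) (v ^+ d) ((-1) ^+ s) => S D e S_neq0 D_neq0 w_neq0 q_neq0 vv.
have q2 : v * S * (v * S) - 1 != 0.
  apply: contraNneq q_neq0 => /eqP; rewrite subr_eq0 => /eqP q1.
  rewrite -[X in _ - X]mul1r -q1 mulfK ?subrr ?mul0r //.
  by rewrite mulf_neq0.
by field; do ![apply/andP; split=> //].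
Qed.

(** This is the factor 1 - z v^a of the q-binomial theorem at z = v^(-a). *)
Lemma alternating_qbinom a :
  \sum_(0 <= t < a.+2) (-1) ^+ t * qbinom v a.+1 t * (v ^- a) ^+ t = 0.
Proof.
rewrite big_nat_recr //= alternating_qbinom_partial // !qbinomn !mulr1.
by rewrite -!exprVn -!exprM [(a * _)%N]mulnC
  [(-1) ^+ a.+1]exprS mulN1r mulNr addrN.
Qed.

End QuantumBinomials.

(** * Elements that q-commute with the Serre elements *)

Section SkewCommutation.
Variables (K : fieldType) (A : algType K).
Implicit Types (f x y : A) (p r al be : K).

Lemma skew_comm_exp f x p al n : f * x = p *: (x * f) + al%:A ->
  f * x ^+ n = p ^+ n *: (x ^+ n * f) + (al * \sum_(k < n) p ^+ k) *: x ^+ n.-1.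
Proof.
move=> fx; elim: n => [|n IHn].
  by rewrite !expr0 mulr1 mul1r scale1r big_ord0 mulr0 scale0r addr0.
rewrite [in LHS]exprSr mulrA IHn mulrDl -!scalerAl -mulrA fx mulrDr -!scalerAr.
rewrite mulr1 scalerDr !scalerA -exprSr mulrA -exprSr -addrA /=; congr (_ + _).
rewrite big_ord_recr mulrDr scalerDl addrC [al * p ^+ n]mulrC /=.
congr (_ + _); case: n {IHn} => [|n]; last by rewrite -exprSr.
by rewrite big_ord0 mulr0 !scale0r.
Qed.

(** Moving f to the right leaves three kinds of error terms: those where al comes
from a power of x on the left of y (G1) or on its right (G3), and those where be
comes from y (G2). G1 and G3 cancel after a shift of the index t by one; the G2
add up to a multiple of an alternating sum of quantum binomials. *)
Lemma q_serre_skew_comm f x y (v : K) a p r al be :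
    v != 0 -> (forall m, (0 < m)%N -> v ^+ m != v ^- m) ->
    f * x = p *: (x * f) + al%:A -> f * y = r *: (y * f) + be%:A ->
    (al != 0 -> p = v ^+ 2 /\ r = v ^- a) -> (be != 0 -> p = v ^- a) ->
  f * q_serre v a x y = (p ^+ a.+1 * r) *: (q_serre v a x y * f).
Proof.
move=> v0 vn fx fy al_p be_p; rewrite /q_serre mulr_sumr mulr_suml scaler_sumr.
pose c t := (-1) ^+ t * qbinom v a.+1 t.
pose s n := \sum_(k < n) p ^+ k.
pose G1 t := (al * (c t * s t)) *: (x ^+ t.-1 * y * x ^+ (a.+1 - t)).
pose G2 t := (be * (c t * p ^+ t)) *: x ^+ a.+1.
pose G3 t := (al * (c t * p ^+ t * r * s (a.+1 - t)%N)) *: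
  (x ^+ t * y * x ^+ (a - t)).
have term t : (t <= a.+1)%N ->
    f * (c t *: (x ^+ t * y * x ^+ (a.+1 - t))) =
    (p ^+ a.+1 * r) *: (c t *: (x ^+ t * y * x ^+ (a.+1 - t)) * f)
      + (G1 t + G2 t + G3 t).
  have pE : (t <= a.+1)%N -> p ^+ a.+1 = p ^+ t * p ^+ (a.+1 - t).
    by move=> le_ta; rewrite -exprD subnKC.
  move=> le_ta; rewrite /G1 /G2 /G3 pE // -scalerAr; move: (c t) => k.
  have -> : f * (x ^+ t * y * x ^+ (a.+1 - t)) =
      p ^+ t *: (x ^+ t * (f * y) * x ^+ (a.+1 - t)) +
      (al * s t) *: (x ^+ t.-1 * y * x ^+ (a.+1 - t)).
    by rewrite !mulrA (skew_comm_exp t fx) !mulrDl -!scalerAl.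
  have -> : x ^+ t * (f * y) * x ^+ (a.+1 - t) =
      r *: (x ^+ t * y * (f * x ^+ (a.+1 - t))) + be *: x ^+ a.+1.
    rewrite fy mulrDr mulrDl -!scalerAr -!scalerAl mulr1 -exprD subnKC //.
    by rewrite !mulrA.
  rewrite (skew_comm_exp (a.+1 - t) fx) subSKn -/(s _).
  rewrite !(mulrDr, scalerDr, =^~ scalerAr, =^~ scalerAl, scalerA) -!mulrA.
  rewrite -!addrA; congr (_ *: _ + _).
    ring.
  rewrite [LHS]addrC [X in X + _ = _]addrC -[LHS]addrA.
  congr (_ *: _ + (_ *: _ + _ *: _)); ring.
under eq_big_nat => t /andP[_ lt_ta] do
  rewrite [_ * qbinom v _ _]/(c t) term //.
rewrite big_split /= -[RHS]addr0; congr (_ + _); rewrite !big_split /=.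
have -> : \sum_(0 <= t < a.+2) G2 t = 0.
  rewrite /G2 -scaler_suml -mulr_sumr.
  have [->|/be_p ->] := eqVneq be 0; first by rewrite mul0r scale0r.
  by rewrite alternating_qbinom // mulr0 scale0r.
(* G1 vanishes at t = 0 and G3 at t = a + 1, so both sums have a + 1 terms. *)
rewrite big_nat_recl //= {1}/G1 {1}/s big_ord0 !mulr0 scale0r add0r addr0.
rewrite [X in _ + X]big_nat_recr //= [G3 a.+1]/G3 subnn [s 0%N]/s big_ord0.
rewrite !mulr0 scale0r addr0 -big_split big_nat big1 //= => t /= lt_ta.
rewrite /G1 /G3 /= subSS -scalerDl -mulrDr.
have [->|/al_p[pE rE]] := eqVneq al 0; first by rewrite mul0r scale0r.
have le_ta : (t <= a)%N by [].
rewrite /s pE rE subSn // !sum_sqr_qint // -subSn // /c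
  -exprM mul2n -addnn exprD.
have binE := qbinomSr vn (le_ta : (t < a.+1)%N).
rewrite -[_ * qbinom v _ t.+1 * _]mulrA [qbinom v _ t.+1 * _]mulrCA binE.
have -> : v ^+ a = v ^+ t * v ^+ (a - t) by rewrite -exprD subnKC.
move: (expf_neq0 t v0) (expf_neq0 (a - t) v0) => vt_neq0 vat_neq0.
rewrite exprS [X in X *: _](_ : _ = 0) ?scale0r //.
by field; apply/andP.
Qed.

(** The degenerate Serre element, attached to orthogonal letters. *)
Lemma commutator_skew_comm f x y p r al be :
    f * x = p *: (x * f) + al%:A -> f * y = r *: (y * f) + be%:A ->
    (al != 0 -> r = 1) -> (be != 0 -> p = 1) ->
  f * (x * y - y * x) = (p * r) *: ((x * y - y * x) * f).
Proof.
move=> fx fy al_r be_p.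
have fxy : f * (x * y) = (p * r) *: (x * y * f) + (p * be) *: x + al *: y.
  rewrite mulrA fx mulrDl -!scalerAl -(mulrA x f) fy mul1r mulrDr -!scalerAr.
  by rewrite mulr1 scalerDr !scalerA mulrA.
have fyx : f * (y * x) = (p * r) *: (y * x * f) + (r * al) *: y + be *: x.
  rewrite mulrA fy mulrDl -!scalerAl -(mulrA y f) fx mul1r mulrDr -!scalerAr.
  by rewrite mulr1 scalerDr !scalerA mulrA [r * p]mulrC.
have al_fix : r * al = al.
  by have [->|/al_r->] := eqVneq al 0; rewrite (mulr0, mul1r).
have be_fix : p * be = be.
  by have [->|/be_p->] := eqVneq be 0; rewrite (mulr0, mul1r).
rewrite mulrBr fxy fyx al_fix be_fix -[X in X - _]addrA
  -[X in _ - X]addrA [al *: y + _]addrC.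
by rewrite [X in _ - X]addrC addrKA mulrBl scalerBr.
Qed.
End SkewCommutation.

(** * The opposite algebra, and the relators *)

(** The relations of the q-boson are exchanged by the anti-involution that swaps
E_i and F_i; in the opposite algebra, the lemmas on
f * R become lemmas on R * e. *)
Section ConverseAlgebra.
Variables (K : fieldType) (A : algType K).

HB.instance Definition _ := GRing.Zmodule_isLmodule.Build K A^c
  (@scalerA K A) (@scale1r K A) (@scalerDr K A) (@scalerDl K A).

Lemma converse_scaleAl (k : K) (x y : A^c) : k *: (x * y) = (k *: x) * y.
Proof. exact: (@scalerAr K A). Qed.
HB.instance Definition _ :=
  GRing.Lmodule_isLalgebra.Build K A^c converse_scaleAl.

Lemma converse_scaleAr (k : K) (x y : A^c) : k *: (x * y) = x * (k *: y).
Proof. exact: (@scalerAl K A). Qed.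
HB.instance Definition _ :=
  GRing.Lalgebra_isAlgebra.Build K A^c converse_scaleAr.

Lemma converse_exp (x : A) n : @GRing.exp A^c x n = x ^+ n.
Proof. by elim: n => // n IHn; rewrite exprS IHn [RHS]exprSr. Qed.
End ConverseAlgebra.

Section OppositeSerre.
Variables (K : fieldType) (v : K).
Hypothesis v_neq0 : v != 0.
Hypothesis v_nroot : forall m, (0 < m)%N -> v ^+ m != v ^- m.
Variable A : algType K.
Implicit Types x y e : A.

Lemma q_serre_converse a x y :
  @q_serre K A^c v a x y = (-1) ^+ a.+1 *: q_serre v a x y.
Proof.
rewrite /q_serre scaler_sumr big_nat_rev /=; apply: eq_big_nat => t /=.
rewrite ltnS add0n subSS => le_ta.
rewrite !converse_exp subKn // scalerA mulrA qbinom_sub //.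
have -> : (-1) ^+ (a.+1 - t) = (-1) ^+ a.+1 * (-1) ^+ t :> K.
  by rewrite -[in RHS](subnK le_ta) exprD -mulrA -expr2 sqrr_sign mulr1.
by congr (_ *: _); rewrite -[RHS]mulrA.
Qed.

Lemma q_serre_skew_comm_converse e x y a p r al be :
    x * e = p *: (e * x) + al%:A -> y * e = r *: (e * y) + be%:A ->
    (al != 0 -> p = v ^+ 2 /\ r = v ^- a) -> (be != 0 -> p = v ^- a) ->
  q_serre v a x y * e = (p ^+ a.+1 * r) *: (e * q_serre v a x y).
Proof.
move=> xe ye al_p be_p.
have sgn_neq0 : (-1) ^+ a.+1 != 0 :> K by rewrite signr_eq0.
apply: (scalerI sgn_neq0).
have := @q_serre_skew_comm K A^c e x y v a p r al be
  v_neq0 v_nroot xe ye al_p be_p.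
rewrite q_serre_converse => eS.
rewrite [LHS]scalerAl scalerA mulrC -scalerA scalerAr; exact: eS.
Qed.

Lemma commutator_skew_comm_converse e x y p r al be :
    x * e = p *: (e * x) + al%:A -> y * e = r *: (e * y) + be%:A ->
    (al != 0 -> r = 1) -> (be != 0 -> p = 1) ->
  (x * y - y * x) * e = (p * r) *: (e * (x * y - y * x)).
Proof.
move=> xe ye al_r be_p; rewrite -[x * y - _]opprB mulNr mulrN scalerN.
congr (- _).
exact: (@commutator_skew_comm K A^c e x y p r al be).
Qed.
End OppositeSerre.

Lemma q_serre_ind (K : fieldType) (A : algType K) (P : A -> Prop) (v : K) a x y :
    P 0 -> (forall f g, P f -> P g -> P (f + g)) ->
    (forall k f, P f -> P (k *: f)) ->
    (forall t, (t <= a.+1)%N -> P (x ^+ t * y * x ^+ (a.+1 - t))) ->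
  P (q_serre v a x y).
Proof.
move=> P0 PD PZ Pxy; rewrite /q_serre big_nat; elim/big_ind: _ => // t.
by rewrite ltnS => le_ta; apply/PZ/Pxy.
Qed.

(** What the q-commutation of relators needs to know about the powers of q. *)
Definition cartan_powers (I : choiceType) (b : I -> I -> rat) (K : fieldType)
    (qpow : rat -> K) : Prop :=
  forall i, 0 < b i i ->
  let v := qpow (b i i / 2) in
  [/\ v != 0, forall m, (0 < m)%N -> v ^+ m != v ^- m, qpow (b i i) = v ^+ 2 &
      forall j, j != i -> qpow (b i j) = v ^- cartan_a b i j].

Section Relators.
Variables (I : choiceType) (b : I -> I -> rat) (K : fieldType) (qpow : rat -> K).

Definition relator (A : algType K) (X : I -> A) (R : A) : Prop :=
  (exists i j, [/\ 0 < b i i, j != i &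
     R = q_serre (qpow (b i i / 2)) (cartan_a b i j) (X i) (X j)]) \/
  (exists i j, b i j = 0 /\ R = X i * X j - X j * X i).

Definition FE_relation (A : algType K) (E F : I -> A) : Prop :=
  forall i j, F i * E j = qpow (b i j) *: (E j * F i) + (i == j)%:R.

Lemma qboson_relationsP (A : algType K) (E F : I -> A) :
    FE_relation E F -> (forall R, relator E R -> R = 0) ->
    (forall R, relator F R -> R = 0) ->
  qboson_relations b qpow E F.
Proof.
move=> FE E0 F0; split=> // [i j bi ij|i j bi ij|i j bij|i j bij].
- by apply: E0; left; exists i, j.
- by apply: F0; left; exists i, j.
- by apply: E0; right; exists i, j.
- by apply: F0; right; exists i, j.
Qed.

Hypothesis b_sym : forall i j, b i j = b j i.
Hypothesis qpow0 : qpow 0 = 1.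
Hypothesis powers : cartan_powers b qpow.

Variables (A : algType K) (E F : I -> A).
Hypothesis FE : FE_relation E F.

Lemma relatorE_skew_comm R k : relator E R ->
  exists z, F k * R = z *: (R * F k).
Proof.
case=> [[i [j [bi_gt0 ji ->]]]|[i [j [bij ->]]]].
  have [v0 vn v2 va] := powers bi_gt0.
  eexists; apply: (q_serre_skew_comm v0 vn
    (al := (k == i)%:R) (be := (k == j)%:R)).
  - by rewrite scaler_nat; exact: FE.
  - by rewrite scaler_nat; exact: FE.
  - by have [->|] := eqVneq k i; rewrite ?eqxx // => _; rewrite v2 va.
  - by have [->|] := eqVneq k j; rewrite ?eqxx // b_sym => _; rewrite va.
eexists; apply: (commutator_skew_comm (al := (k == i)%:R) (be := (k == j)%:R)).
- by rewrite scaler_nat; exact: FE.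
- by rewrite scaler_nat; exact: FE.
- by have [->|] := eqVneq k i; rewrite ?eqxx // bij.
- by have [->|] := eqVneq k j; rewrite ?eqxx // b_sym bij.
Qed.

Lemma relatorF_skew_comm R k : relator F R ->
  exists z, R * E k = z *: (E k * R).
Proof.
case=> [[i [j [bi_gt0 ji ->]]]|[i [j [bij ->]]]].
  have [v0 vn v2 va] := powers bi_gt0.
  eexists; apply: (q_serre_skew_comm_converse v0 vn
    (al := (i == k)%:R) (be := (j == k)%:R)).
  - by rewrite scaler_nat; exact: FE.
  - by rewrite scaler_nat; exact: FE.
  - by have [<-|] := eqVneq i k; rewrite ?eqxx // b_sym => _; rewrite v2 va.
  - by have [<-|] := eqVneq j k; rewrite ?eqxx // => _; rewrite va.
eexists; apply: (commutator_skew_comm_converse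
  (al := (i == k)%:R) (be := (j == k)%:R)).
- by rewrite scaler_nat; exact: FE.
- by rewrite scaler_nat; exact: FE.
- by have [<-|] := eqVneq i k; rewrite ?eqxx // b_sym bij.
- by have [<-|] := eqVneq j k; rewrite ?eqxx // bij.
Qed.

End Relators.

(** * Powers of q *)

Section PowersOfQ.
Variables (L : zmodClosed rat) (K : fieldType) (qpow : rat -> K).
Hypothesis KQq : is_Qq L qpow.

Lemma qpow_neq0 r : r \in L -> qpow r != 0.
Proof.
move=> rL; apply: contra_eq_neq (Qq_powD KQq rL (rpredNr rL)) => ->.
by rewrite subrr (Qq_pow0 KQq) mul0r oner_neq0.
Qed.

Lemma qpowN r : r \in L -> qpow (- r) = (qpow r)^-1.
Proof.
move=> rL; apply: (mulfI (qpow_neq0 rL)).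
by rewrite -(Qq_powD KQq) ?rpredN // subrr (Qq_pow0 KQq) mulfV ?qpow_neq0.
Qed.

Lemma qpowMn r n : r \in L -> qpow (r *+ n) = qpow r ^+ n.
Proof.
move=> rL; elim: n => [|n IHn]; first by rewrite mulr0n (Qq_pow0 KQq).
by rewrite mulrS (Qq_powD KQq) ?rpredMn // IHn exprS.
Qed.

Lemma q_nroot1 n : (0 < n)%N -> qpow 1 ^+ n != 1.
Proof.
move=> n_gt0; have := Qq_transcendental KQq (p := 'X^n - 1).
rewrite -size_poly_eq0 size_XnsubC // => /(_ isT).
have -> : map_poly ratr ('X^n - 1) = 'X^n - 1 :> {poly K}.
  have ratr0 : ratr 0 = 0 :> K by rewrite /ratr mul0r.
  apply/polyP=> i; rewrite coef_map_id0 // !coefB !coefXn !coef1.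
  have [->|i_neqn] := eqVneq i n; first rewrite gtn_eqF //.
    by rewrite !subr0 /ratr divr1.
  by case: (i == 0%N); rewrite ?subrr // !sub0r /ratr divr1.
by rewrite !hornerE subr_eq0.
Qed.

(** Some power of q^r, with r positive rational, is a positive integral power of q. *)
Lemma qpow_nroot1 r n : r \in L -> 0 < r -> (0 < n)%N -> qpow r ^+ n != 1.
Proof.
move=> rL r_gt0 n_gt0.
have num_gt0 : (0 < absz (numq r))%N by rewrite absz_gt0 numq_eq0 gt_eqF.
apply: contraNneq (q_nroot1 (ltn_mul num_gt0 n_gt0)) => rn.
have rE : r *+ absz (denq r) = 1 *+ absz (numq r).
  rewrite -[LHS]mulr_natr -[RHS]mulr_natr mul1r.
  rewrite -[(absz (denq r))%:R]/((absz (denq r) : int)%:~R) absz_denq.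
  rewrite -[(absz (numq r))%:R]/((absz (numq r) : int)%:~R).
  by rewrite gez0_abs ?numq_ge0 1?ltW // numqE.
by rewrite exprM -qpowMn ?(Qq_1 KQq) // -rE qpowMn // exprAC rn expr1n.
Qed.

Lemma qpow_expr_neqV r m : r \in L -> 0 < r -> (0 < m)%N ->
  qpow r ^+ m != qpow r ^- m.
Proof.
move=> rL r_gt0 m_gt0; have qm_neq0 := expf_neq0 m (qpow_neq0 rL).
have m2_gt0 : (0 < m * 2)%N by rewrite muln_gt0 m_gt0.
apply: contraNneq (qpow_nroot1 rL r_gt0 m2_gt0) => e.
by rewrite exprM expr2 {1}e mulVf.
Qed.

Variables (I : choiceType) (b : I -> I -> rat).
Hypotheses (bBC : Borcherds_Cartan b) (bL : exponents_in b L).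

Lemma cartan_aE i j : 0 < b i i -> j != i ->
  b i j = - (b i i / 2 *+ cartan_a b i j).
Proof.
move=> bi_gt0 ji; rewrite -mulr_natr /cartan_a truncnK.
  by field; rewrite gt_eqF.
rewrite natrEint rpredN BC_int // oppr_ge0.
by rewrite pmulr_lle0 ?invr_gt0 // pmulr_rle0 // BC_le0 // eq_sym.
Qed.

Lemma qpow_cartan_powers : cartan_powers b qpow.
Proof.
move=> i bi_gt0 v; have dL := bL.2 i bi_gt0; split.
- exact: qpow_neq0.
- by move=> m; apply: qpow_expr_neqV => //; rewrite divr_gt0.
- by rewrite -qpowMn // -[_ *+ 2]mulr_natr divfK.
- by move=> j ji; rewrite (cartan_aE bi_gt0 ji) qpowN ?rpredMn // qpowMn.
Qed.
End PowersOfQ.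

(** * The operators E and F on functions on words *)

Section WordFunctions.
Variables (I : choiceType) (b : I -> I -> rat) (K : fieldType) (qpow : rat -> K).

Definition wordfun : Type := seq I -> K^o.
HB.instance Definition _ := GRing.Lmodule.on wordfun.
Implicit Types (phi psi : wordfun) (w s : seq I) (i j k : I).

Definition delta_nil : wordfun := fun w => (w == [::])%:R.

Lemma delta_nil_neq0 : delta_nil != 0.
Proof.
by apply/eqP => /(congr1 (fun phi : wordfun => phi [::])) /eqP; rewrite oner_eq0.
Qed.

Definition shift s phi : wordfun := fun w => phi (s ++ w).

(** The recursion is the relation F_j E_k = q^(j, k) E_k F_j + delta_jk, evaluated
at w'. *)
Fixpoint q_insert k phi w : K :=
  if w is j :: w' then
    qpow (b j k) * q_insert k (shift [:: j] phi) w' + (j == k)%:R * phi w'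
  else 0.

(** E_k phi at w only depends on phi at the words obtained from w by deleting a
letter k; both the degree and the letters of the support are thus controlled. *)
Lemma q_insert_local k phi w :
  (forall w', perm_eq w (k :: w') -> phi w' = 0) -> q_insert k phi w = 0.
Proof.
elim: w phi => // j w IHw phi phi0 /=; rewrite IHw => [|w' pw].
  rewrite mulr0 add0r; have [ejk|] := eqVneq j k; last by rewrite mul0r.
  by rewrite phi0 ?mulr0 // ejk.
apply: phi0; rewrite perm_sym (perm_catCA [:: k] [:: j] w') perm_cons perm_sym //.
Qed.

Lemma q_insert_linear k : linear (q_insert k : wordfun -> wordfun).
Proof.
move=> a phi psi; apply/funext => w.
rewrite -[RHS]/(a * q_insert k phi w + q_insert k psi w).
elim: w phi psi => [|j w IHw] phi psi /=; first by rewrite mulr0 addr0.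
rewrite -[shift _ _]/(a *: shift [:: j] phi + shift [:: j] psi) IHw.
by rewrite -[(a *: phi + psi) w]/(a * phi w + psi w); ring.
Qed.

Notation lendW := (lend delta_nil_neq0).

Lemma shift_linear s : linear (shift s).
Proof. by []. Qed.

Definition Eword k : lendW :=
  Lend delta_nil_neq0 (introT (linear_predP _) (@q_insert_linear k)).
Definition Fword i : lendW :=
  Lend delta_nil_neq0 (introT (linear_predP _) (@shift_linear [:: i])).

Lemma FE_word : FE_relation b qpow Eword Fword.
Proof.
move=> i j; apply: lend_inj => phi; apply/funext => w.
rewrite [LHS]/(_ * _ + (i == j)%:R * phi w).
by case: (i == j); rewrite ?mul1r ?mul0r.
Qed.

Hypothesis b_sym : forall i j, b i j = b j i.
Hypothesis qpow0 : qpow 0 = 1.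
Hypothesis powers : cartan_powers b qpow.

(** The values of E_k phi at the empty word are zero, and the leftmost factor of
each monomial of a relator is an E. *)
Lemma relatorE_word_nil R phi : relator b qpow Eword R -> lend_fun R phi [::] = 0.
Proof.
case=> [[i [j [_ _ ->]]]|[i [j [_ ->]]]]; last exact: subrr.
pose P (f : lendW) := lend_fun f phi [::] = 0.
apply: (q_serre_ind (P := P)) => //.
- by move=> f g f0 g0; rewrite /P [LHS](congr2 +%R f0 g0) addr0.
- by move=> k f f0; rewrite /P [LHS](congr1 (fun x => k * x) f0) mulr0.
by case=> // t _; rewrite /P exprS -!mulrA.
Qed.

(** Evaluation at k :: w is evaluation at w after F_k, which q-commutes with R. *)
Lemma relatorE_word R : relator b qpow Eword R -> R = 0.
Proof.
move=> relR; apply: lend_inj => phi; apply/funext => w.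
elim: w phi => [|k w IHw] phi; first exact: relatorE_word_nil.
have [z FR] := relatorE_skew_comm b_sym qpow0 powers FE_word k relR.
rewrite -[LHS]/(lend_fun (Fword k * R) phi w) FR.
by rewrite -[LHS]/(z * lend_fun R (shift [:: k] phi) w) IHw mulr0.
Qed.

(** Relators have degree at least two. *)
Lemma relatorF_word_low R phi : relator b qpow Fword R ->
  (forall w, (2 <= size w)%N -> phi w = 0) -> lend_fun R phi = 0.
Proof.
have Fexp i n psi w : lend_fun (Fword i ^+ n) psi w = psi (nseq n i ++ w).
  by elim: n psi => // n IHn psi; rewrite exprSr [LHS]IHn.
move=> relR phi0; apply/funext => w.
case: relR => [[i [j [_ _ ->]]]|[i [j [_ ->]]]]; last first.
  rewrite [LHS]/(phi [:: j, i & w] - phi [:: i, j & w]) !phi0 //; exact: subrr.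
pose P (f : lendW) := lend_fun f phi w = 0.
apply: (q_serre_ind (P := P)) => //.
- by move=> f g f0 g0; rewrite /P [LHS](congr2 +%R f0 g0) addr0.
- by move=> k f f0; rewrite /P [LHS](congr1 (fun x => k * x) f0) mulr0.
move=> t le_t; set x := Fword i; set m := (_ - t)%N.
rewrite /P [LHS](Fexp i t (lend_fun (Fword j * x ^+ m) phi)).
rewrite [LHS](Fexp i m phi (j :: nseq t i ++ w)) phi0 // size_cat /= size_cat.
by rewrite !size_nseq addnS addnA subnK // addSn.
Qed.

(** * The Fock module *)

(** The bound on the length gives membership in O. The other condition amounts to
vanishing on the two-sided ideal that the relators generate in the free algebra
on the F's: [shift s phi] is the image of phi under the product of the F_i for i
in s, where the first letter of s acts first. *)
Definition qboson_wordfun : {pred wordfun} := [pred phi : wordfun |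
  `[< (exists l, forall w, (l <= size w)%N -> phi w = 0) /\
      (forall R, relator b qpow Fword R ->
         forall s, lend_fun R (shift s phi) = 0) >]].

Lemma qboson_wordfunP phi : reflect
  ((exists l, forall w, (l <= size w)%N -> phi w = 0) /\
   (forall R, relator b qpow Fword R ->
      forall s, lend_fun R (shift s phi) = 0))
  (phi \in qboson_wordfun).
Proof. exact: asboolP. Qed.

Lemma qboson_wordfun_submod : GRing.submod_closed qboson_wordfun.
Proof.
split=> [|a phi psi /qboson_wordfunP[[l phi0] Rphi]
  /qboson_wordfunP[[m psi0] Rpsi]];
  apply/qboson_wordfunP; split.
- by exists 0.
- move=> R _ s; exact: raddf0.
- exists (maxn l m) => w; rewrite geq_max => /andP[lw mw].
  by rewrite -[LHS]/(a * phi w + psi w) phi0 // psi0 // mulr0 addr0.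
- move=> R relR s; rewrite [LHS](lend_linear R a (shift s phi) (shift s psi)).
  by rewrite Rphi // Rpsi // scaler0 addr0.
Qed.
HB.instance Definition _ := GRing.isSubmodClosed.Build K wordfun qboson_wordfun
  qboson_wordfun_submod.

Lemma Fword_stable i phi : phi \in qboson_wordfun ->
  lend_fun (Fword i) phi \in qboson_wordfun.
Proof.
move=> /qboson_wordfunP[[l phi0] Rphi]; apply/qboson_wordfunP; split.
  by exists l => w lw; apply: phi0; exact: leqW.
by move=> R relR s; exact: (Rphi R relR (i :: s)).
Qed.

(** A monomial in the F's moves past E_k at the cost of shorter monomials
(induction on s), and R moves past E_k up to a scalar. *)
Lemma Eword_stable k phi : phi \in qboson_wordfun ->
  lend_fun (Eword k) phi \in qboson_wordfun.
Proof.
move=> phiV; apply/qboson_wordfunP; split.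
  have /qboson_wordfunP[[l phi0] _] := phiV.
  exists l.+1 => w lw; apply: q_insert_local => w' /perm_size sw.
  by apply: phi0; rewrite sw in lw.
move=> R relR s; elim: s phi phiV => [|j s IHs] phi phiV.
  have [z RE] := relatorF_skew_comm b_sym qpow0 powers FE_word k relR.
  rewrite -[LHS]/(lend_fun (R * Eword k) phi) RE.
  rewrite -[LHS]/(z *: lend_fun (Eword k) (lend_fun R (shift [::] phi))).
  have /qboson_wordfunP[_ ->] // := phiV.
  by rewrite [X in z *: X]raddf0 scaler0.
rewrite -[X in lend_fun R X]/(qpow (b j k) *:
  shift s (lend_fun (Eword k) (lend_fun (Fword j) phi)) +
  (j == k)%:R *: shift s phi).
rewrite lend_linear IHs ?Fword_stable // scaler0 add0r.
have [_ Rphi] := qboson_wordfunP _ phiV.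
have -> : lend_fun R ((j == k)%:R *: shift s phi) =
    (j == k)%:R *: lend_fun R (shift s phi) by exact: linearZZ.
by rewrite Rphi // scaler0.
Qed.

Lemma qboson_wordfun_low phi :
  (forall w, (2 <= size w)%N -> phi w = 0) -> phi \in qboson_wordfun.
Proof.
move=> phi0; apply/qboson_wordfunP; split=> [|R relR s]; first by exists 2%N.
apply: relatorF_word_low => // w lt1w.
by apply: phi0; rewrite size_cat (leq_trans lt1w) // leq_addl.
Qed.

Record Fock : Type :=
  MkFock {Fock_fun : wordfun; _ : Fock_fun \in qboson_wordfun}.
HB.instance Definition _ := [isSub for Fock_fun].
HB.instance Definition _ := [Choice of Fock by <:].
HB.instance Definition _ := [SubChoice_isSubLmodule of Fock by <:].
Implicit Types x y : Fock.

Lemma vac_subproof : delta_nil \in qboson_wordfun.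
Proof. by apply: qboson_wordfun_low => -[]. Qed.
Definition vac : Fock := MkFock vac_subproof.

Lemma vac_neq0 : vac != 0.
Proof. by apply: contra_neq delta_nil_neq0 => /(congr1 val). Qed.

Notation lendV := (lend vac_neq0).

Definition EFock_fun k x : Fock := MkFock (Eword_stable k (valP x)).
Definition FFock_fun i x : Fock := MkFock (Fword_stable i (valP x)).

Lemma EFock_linear k : linear (EFock_fun k).
Proof. by move=> a x y; apply: val_inj; exact: (lend_linear (Eword k)). Qed.

Lemma FFock_linear i : linear (FFock_fun i).
Proof. by move=> a x y; apply: val_inj. Qed.

Definition EFock k : lendV :=
  Lend vac_neq0 (introT (linear_predP _) (@EFock_linear k)).
Definition FFock i : lendV :=
  Lend vac_neq0 (introT (linear_predP _) (@FFock_linear i)).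

(** The relations are known for operators on all functions on words; this relation
transports them to the submodule. *)
Definition restricts_to (f : lendW) (g : lendV) : Prop :=
  forall x, val (lend_fun g x) = lend_fun f (val x).

Lemma restrictsM f f' g g' :
  restricts_to f g -> restricts_to f' g' -> restricts_to (f * f') (g * g').
Proof. by move=> fg fg' x; rewrite [LHS]fg fg'. Qed.

Lemma restrictsX f g n : restricts_to f g -> restricts_to (f ^+ n) (g ^+ n).
Proof. by move=> fg; elim: n => // n IHn; rewrite !exprS; exact: restrictsM. Qed.

Lemma restrictsD f f' g g' :
  restricts_to f g -> restricts_to f' g' -> restricts_to (f + f') (g + g').
Proof. by move=> fg fg' x; rewrite [LHS](congr2 +%R (fg x) (fg' x)). Qed.

Lemma restrictsZ a f g : restricts_to f g -> restricts_to (a *: f) (a *: g).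
Proof. by move=> fg x; rewrite [LHS](congr1 ( *:%R a) (fg x)). Qed.

Lemma restricts_relator (X : I -> lendW) (Y : I -> lendV) R :
    (forall i, restricts_to (X i) (Y i)) -> relator b qpow Y R ->
  exists2 R', relator b qpow X R' & restricts_to R' R.
Proof.
move=> XY [[i [j [bi ji ->]]]|[i [j [bij ->]]]].
  exists (q_serre (qpow (b i i / 2)) (cartan_a b i j) (X i) (X j)).
    by left; exists i, j.
  rewrite /q_serre; elim/big_ind2: _ => // [f f' g g'|t _].
    exact: restrictsD.
  by apply: restrictsZ; do 2?[apply: restrictsM]; do ?[apply: restrictsX].
exists (X i * X j - X j * X i); first by right; exists i, j.
apply: restrictsD; first exact: restrictsM.
by rewrite -!scaleN1r; apply/restrictsZ/restrictsM.
Qed.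

Lemma relator_Fock (X : I -> lendW) (Y : I -> lendV) :
    (forall i, restricts_to (X i) (Y i)) ->
    (forall R x, relator b qpow X R -> lend_fun R (val x) = 0) ->
  forall R, relator b qpow Y R -> R = 0.
Proof.
move=> XY X0 R /(restricts_relator XY)[R' relR' R'R].
by apply: lend_inj => x; apply: val_inj; rewrite R'R X0 // linear0.
Qed.

Lemma qboson_Fock : qboson_relations b qpow EFock FFock.
Proof.
apply: qboson_relationsP.
- move=> i j; apply: lend_inj => x; apply: val_inj.
  rewrite [LHS](congr1 (fun f => lend_fun f (val x)) (FE_word i j)).
  by case: (i == j).
- apply: (relator_Fock (X := Eword)) => [|R x relR]; first by [].
  by rewrite (relatorE_word relR).
- apply: (relator_Fock (X := Fword)) => [|R x relR]; first by [].
  have [_ Rx] := qboson_wordfunP _ (valP x); exact: (Rx R relR [::]).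
Qed.

End WordFunctions.

(** * Generation of the q-boson by the E's and F's *)

Section SubalgebraType.
Variables (K : fieldType) (A : algType K) (S : subalgClosed A).

Record subalg : Type := MkSubalg {subalg_val : A; _ : subalg_val \in S}.
HB.instance Definition _ := [isSub for subalg_val].
HB.instance Definition _ := [Choice of subalg by <:].
HB.instance Definition _ := [SubChoice_isSubAlgebra of subalg by <:].

Definition subalg_incl (x : subalg) : A := val x.
HB.instance Definition _ := GRing.isLinear.Build K subalg A *:%R subalg_incl
  (@linearP _ _ _ _ (val : {linear subalg -> A})).
HB.instance Definition _ := GRing.isMonoidMorphism.Build subalg A subalg_incl
  (rmorph1 (val : {rmorphism subalg -> A}),
   rmorphM (val : {rmorphism subalg -> A})).
End SubalgebraType.

Section Generation.
Variables (I : choiceType) (b : I -> I -> rat) (K : fieldType) (qpow : rat -> K).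

Lemma rmorph_q_serre (A A' : algType K) (f : {lrmorphism A -> A'}) (v : K) a x y :
  f (q_serre v a x y) = q_serre v a (f x) (f y).
Proof.
rewrite /q_serre linear_sum; apply: eq_bigr => t _.
by rewrite linearZZ !rmorphM /= !rmorphXn.
Qed.

Lemma qboson_relations_inj (A A' : algType K) (f : {lrmorphism A -> A'})
    (E F : I -> A) : injective f ->
  qboson_relations b qpow (f \o E) (f \o F) -> qboson_relations b qpow E F.
Proof.
move=> f_inj [FE sE sF cE cF].
split=> [i j|i j bi ij|i j bi ij|i j bij|i j bij]; apply: f_inj.
- by rewrite rmorphM [LHS]FE rmorphD /= linearZZ /= rmorphM rmorph_nat.
- by rewrite rmorph_q_serre rmorph0; exact: sE.
- by rewrite rmorph_q_serre rmorph0; exact: sF.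
- by rewrite rmorphB !rmorphM rmorph0; exact: cE.
- by rewrite rmorphB !rmorphM rmorph0; exact: cF.
Qed.

(** The universal property maps B to the subalgebra P, and its uniqueness part
identifies the composite B -> P -> B with the identity. *)
Lemma qboson_generated (B : algType K) (E F : I -> B) (P : {pred B}) :
    is_qboson b qpow E F -> GRing.subalg_closed P ->
    (forall i, E i \in P) -> (forall i, F i \in P) ->
  forall x, x \in P.
Proof.
move=> Bqb P_alg PE PF x.
pose S : subalgClosed B := HB.pack P (GRing.isSubalgClosed.Build K B P P_alg).
pose E' i := MkSubalg (PE i : E i \in S).
pose F' i := MkSubalg (PF i : F i \in S).
have rel' : qboson_relations b qpow E' F'.
  apply: (qboson_relations_inj (f := @subalg_incl K B S)); first exact: val_inj.
  exact: qboson_rel Bqb.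
have [phi [phiE phiF]] := qboson_ex Bqb rel'.
have -> : x = val (phi x).
  have := qboson_uniq Bqb (phi := idfun) (psi := @subalg_incl K B S \o phi).
  by apply=> i; rewrite /= ?phiE ?phiF.
exact: (valP (phi x)).
Qed.
End Generation.

(** * The module attached to a representation *)

Section Representation.
Variables (K : fieldType) (V : lmodType K) (v : V) (vN0 : v != 0).
Variable B : algType K.

(** The representation occurs in the type so that the action of B can be inferred. *)
Definition repr_module (phi : {lrmorphism B -> lend vN0}) : Type := V.

Variable phi : {lrmorphism B -> lend vN0}.
Notation M := (repr_module phi).
HB.instance Definition _ := GRing.Zmodule.on M.

Definition repr_scale (a : B) (x : M) : M := lend_fun (phi a) x.

Lemma repr_scaleA a c x : repr_scale a (repr_scale c x) = repr_scale (a * c) x.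
Proof. by rewrite /repr_scale rmorphM. Qed.
Lemma repr_scale1 : left_id 1 repr_scale.
Proof. by move=> x; rewrite /repr_scale rmorph1. Qed.
Lemma repr_scaleDr : right_distributive repr_scale +%R.
Proof. by move=> a x y; exact: linearD. Qed.
Lemma repr_scaleDl x : {morph repr_scale^~ x : a c / a + c}.
Proof. by move=> a c; rewrite /repr_scale rmorphD. Qed.
HB.instance Definition _ := GRing.Zmodule_isLmodule.Build B M
  repr_scaleA repr_scale1 repr_scaleDr repr_scaleDl.
End Representation.

(** * Simple submodules and the failure of semisimplicity *)

Section NonSemisimple.
Variables (I : choiceType) (b : I -> I -> rat) (K : fieldType) (qpow : rat -> K).
Hypothesis b_sym : forall i j, b i j = b j i.
Hypothesis qpow0 : qpow 0 = 1.
Hypothesis powers : cartan_powers b qpow.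
Variables (B : algType K) (E F : I -> B) (Bqb : is_qboson b qpow E F).

Notation Vac := (vac_neq0 b qpow).
Variable rho : {lrmorphism B -> lend Vac}.
Hypothesis rhoE : forall k, rho (E k) = EFock b_sym qpow0 powers k.
Hypothesis rhoF : forall i, rho (F i) = FFock b qpow i.
Notation M := (repr_module rho).
Implicit Types u x y : M.

Definition word_value x : wordfun I K := Fock_fun x.

Lemma word_value_inj : injective word_value.
Proof. exact: val_inj. Qed.

Lemma word_valueD x y w : word_value (x + y) w = word_value x w + word_value y w.
Proof. by []. Qed.

Lemma word_value_F i x w : word_value (F i *: x) w = word_value x (i :: w).
Proof. by rewrite [F i *: x]/(repr_scale _ _) /repr_scale rhoF. Qed.

Lemma word_value_E k x : word_value (E k *: x) = q_insert b qpow k (word_value x).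
Proof. by rewrite [E k *: x]/(repr_scale _ _) /repr_scale rhoE. Qed.

Lemma word_valueZ (a : K) x w : word_value (a%:A *: x) w = a * word_value x w.
Proof.
rewrite [a%:A *: x]/(repr_scale _ _) /repr_scale linearZZ rmorph1.
by [].
Qed.

Lemma word_value_Fword s x w :
  word_value (F_word F s x) w = word_value x (catrev s w).
Proof. by elim: s w => //= i s IHs w; rewrite word_value_F IHs. Qed.

Lemma Fock_in_O : in_O F M.
Proof.
move=> x; have [[l x0] _] := qboson_wordfunP _ _ _ (valP (x : Fock b qpow)).
exists l => s; apply: word_value_inj; apply/funext => w.
by rewrite word_value_Fword [LHS]x0 //
  catrevE size_cat size_rev size_tuple leq_addr.
Qed.

Definition letters_in (s : seq I) x : Prop :=
  forall w, ~~ all (mem s) w -> word_value x w = 0.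

Definition finitely_many_letters : {pred M} :=
  [pred x : M | `[< exists s, letters_in s x >]].

Lemma finitely_many_lettersP x :
  reflect (exists s, letters_in s x) (x \in finitely_many_letters).
Proof. exact: asboolP. Qed.

Lemma finitely_many_lettersD x y :
  x \in finitely_many_letters -> y \in finitely_many_letters ->
  x + y \in finitely_many_letters.
Proof.
move=> /finitely_many_lettersP[s xs] /finitely_many_lettersP[t yt].
apply/finitely_many_lettersP; exists (s ++ t) => w wst.
rewrite word_valueD xs ?yt ?addr0 //; apply: contra wst;
  by apply: sub_all => i /= i_in; rewrite mem_cat i_in ?orbT.
Qed.

Lemma finitely_many_lettersF i x :
  x \in finitely_many_letters -> F i *: x \in finitely_many_letters.
Proof.
move=> /finitely_many_lettersP[s xs]; apply/finitely_many_lettersP.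
by exists s => w ws; rewrite word_value_F xs //= negb_and ws orbT.
Qed.

Lemma finitely_many_lettersE k x :
  x \in finitely_many_letters -> E k *: x \in finitely_many_letters.
Proof.
move=> /finitely_many_lettersP[s xs]; apply/finitely_many_lettersP.
exists (k :: s) => w wks; rewrite word_value_E; apply: q_insert_local => w' pw.
apply: xs; apply: contra wks; rewrite (perm_all _ pw) /= mem_head /=.
by apply: sub_all => i /= i_in; rewrite inE i_in orbT.
Qed.

(** By generation it suffices to treat the actions of E_k and F_i. *)
Lemma finitely_many_letters_act (a : B) x :
  x \in finitely_many_letters -> a *: x \in finitely_many_letters.
Proof.
pose P : {pred B} := [pred a | `[< forall x, x \in finitely_many_letters ->
                                   a *: x \in finitely_many_letters >]].
suff /asboolP aP : a \in P by exact: aP.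
apply: (qboson_generated Bqb) => [|i|i]; last 2 first.
- by apply/asboolP=> y; exact: finitely_many_lettersE.
- by apply/asboolP=> y; exact: finitely_many_lettersF.
split=> [|c f g /asboolP fP /asboolP gP|f g /asboolP fP /asboolP gP].
- by apply/asboolP=> y yP; rewrite scale1r.
- apply/asboolP=> y yP; rewrite scalerDl finitely_many_lettersD ?gP //.
  rewrite -mulr_algl -scalerA.
  have /finitely_many_lettersP[s fs] := fP _ yP; apply/finitely_many_lettersP.
  by exists s => w ws; rewrite word_valueZ fs // mulr0.
- by apply/asboolP=> y yP; rewrite -scalerA fP ?gP.
Qed.

Lemma finitely_many_letters_submod : GRing.submod_closed finitely_many_letters.
Proof.
split=> [|a x y xP yP]; first by apply/finitely_many_lettersP; exists [::].
by rewrite finitely_many_lettersD ?finitely_many_letters_act.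
Qed.

Notation vacM := (vac b qpow : M).

Lemma vac_finitely_many_letters : vacM \in finitely_many_letters.
Proof. by apply/finitely_many_lettersP; exists [::]; case. Qed.

(** Apply F's as long as the result is nonzero: a function killed by all of them is
supported on the empty word. *)
Lemma submod_vac (N : {pred M}) x :
  GRing.submod_closed N -> x \in N -> x != 0 -> vacM \in N.
Proof.
move=> [N0 Nlin] xN x_neq0.
have NZ a y : y \in N -> a *: y \in N by move=> yN; rewrite -[_ *: _]addr0 Nlin.
have [[l xl] _] := qboson_wordfunP _ _ _ (valP (x : Fock b qpow)).
elim: l x xN x_neq0 xl => [|l IHl] x xN x_neq0 xl.
  by case/eqP: x_neq0; apply: word_value_inj; apply/funext => w; exact: xl.
have [[i Fx_neq0]|Fx0] := pselect (exists i, F i *: x != 0).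
  apply: (IHl (F i *: x)) => // [|w lw]; first exact: NZ.
  by rewrite [LHS]word_value_F; exact: xl.
have x_cons i w : word_value x (i :: w) = 0.
  rewrite -word_value_F; have [-> //|Fx_neq0] := eqVneq (F i *: x) 0.
  by case: Fx0; exists i.
have x_nil : word_value x [::] != 0.
  apply: contra_neq x_neq0 => x_nil; apply: word_value_inj; apply/funext.
  by case=> [|i w]; [exact: x_nil | exact: x_cons].
pose a : B := (word_value x [::])^-1%:A.
suff ax : a *: x = vacM by have := NZ a x xN; rewrite ax.
apply: word_value_inj; apply/funext => -[|i w]; rewrite word_valueZ.
  by rewrite mulVf.
by rewrite x_cons mulr0.
Qed.

(** The intersection of N with the submodule of functions involving finitely many
letters contains the vacuum, so it is not zero and equals N. *)
Lemma simple_finitely_many_letters (N : {pred M}) x :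
  simple_O_sub F N -> x \in N -> x \in finitely_many_letters.
Proof.
move=> [N_sub _ [y yN y_neq0] N_min] xN.
have vacN := submod_vac N_sub yN y_neq0.
pose N' : {pred M} := [pred z | (z \in N) && (z \in finitely_many_letters)].
have N'_sub : GRing.submod_closed N'.
  have [[N0 Nlin] [L0 Llin]] := (N_sub, finitely_many_letters_submod).
  split=> [|a z t /andP[zN zL] /andP[tN tL]]; first by apply/andP.
  by apply/andP; split; [exact: Nlin | exact: Llin].
case: (N_min N' N'_sub) => [z /andP[] //|N'0|N'N].
  have vacN' : vacM \in N'.
    by apply/andP; split; [exact: vacN | exact: vac_finitely_many_letters].
  have := N'0 vacM; rewrite vacN' => /esym/eqP vac0.
  by have /eqP := vac_neq0 b qpow.
by have := N'N x; rewrite xN => /andP[].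
Qed.

Lemma length1_subproof :
  (fun w => (size w == 1%N)%:R : K^o) \in qboson_wordfun b qpow.
Proof. by apply: qboson_wordfun_low => -[|i [|j w]]. Qed.

(** The vector that exhibits the failure: formally it is the sum over all i in I of
the E_i applied to the vacuum. *)
Definition length1 : M := MkFock length1_subproof.

Lemma Fock_not_semisimple : infinite_set [set: I] -> ~ semisimple_O F M.
Proof.
move=> infI /(_ length1)[s length1E sN].
have : length1 \in finitely_many_letters.
  rewrite length1E big_seq; elim/big_ind: _ => [|x y|x /sN[N N_simple xN]].
  - by have [] := finitely_many_letters_submod.
  - exact: finitely_many_lettersD.
  - exact: simple_finitely_many_letters xN.
move=> /finitely_many_lettersP[t length1_t]; apply: infI.
apply: (sub_finite_set _ (finite_seq t)) => i _ /=.
apply: contraT => it; have := length1_t [:: i]; rewrite /= andbT => /(_ it) /eqP.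
by rewrite oner_eq0.
Qed.
End NonSemisimple.

Theorem mainTheorem1 (I : countType) (infI : infinite_set [set: I])
    (b : I -> I -> rat) (bBC : Borcherds_Cartan b)
    (L : zmodClosed rat) (bL : exponents_in b L)
    (K : fieldType) (qpow : rat -> K) (KQq : is_Qq L qpow)
    (B : algType K) (E F : I -> B) (Bqb : is_qboson b qpow E F) :
  exists M : lmodType B, in_O F M /\ ~ semisimple_O F M.
Proof.
have b_sym := BC_sym bBC; have qpow0 := Qq_pow0 KQq.
have powers := qpow_cartan_powers KQq bBC bL.
have [rho [rhoE rhoF]] := qboson_ex Bqb (qboson_Fock b_sym qpow0 powers).
exists (repr_module rho); split; first exact: Fock_in_O rhoF.
exact: (Fock_not_semisimple Bqb rhoE rhoF).
Qed.
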